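(* Consider the disk evacuation problem and the algorithm $\mathcal C(\chi,\phi,\lambda)$ described in the context, with parameters $\chi_0=2.631865$, $\phi_0=0.44916$ and $\lambda_0=0.05762$. The evacuation time of $\mathcal C(\chi_0,\phi_0,\lambda_0)$ (its worst case over all positions of the exit on the boundary circle) is at most $5.628$.
   Context: Disk evacuation problem: two robots $R_1,R_2$ start at time $0$ at the centre $O$ of a disk of radius $1$. An exit is located at an unknown point of the boundary circle. Each robot can move anywhere in the disk with speed at most $1$; a robot learns the location of the exit only when it is at that point. The robots can exchange information only when they are at the same point at the same time (face-to-face communication). For a given exit position, the evacuation time is the time at which both robots have reached the exit; the evacuation time of an algorithm is the supremum of this over all exit positions. Coordinates: $O=(0,0)$, $A=(0,1)$, $A'=(0,-1)$; for $s\in[0,\pi]$ let $P(s)=(\sin s,\cos s)$ and $\bar P(s)=(-\sin s,\cos s)$ (the boundary points at arc distance $s$ from $A$ on either side). For $x\in[0,\pi]$ let $f(x)$ be the unique $z$ with $z=2\sin(x-z/2)$; let $x_0\approx 2.85344$ be the point at which $x+f(x)$ attains its maximum over $[0,\pi]$. Meeting protocol: if at time $t_0$ a robot finds the exit at point $X$, it computes the smallest $t\ge 0$ such that the other robot, continuing on its prescribed trajectory, is at time $t_0+t$ at a point $M$ with $|XM|=t$; it walks along the segment $XM$, meets the other robot at $M$ at time $t_0+t$, and both then walk straight back to $X$ (total time $t_0+2t$). Algorithm $\mathcal C(\chi,\phi,\lambda)$, for $\chi\in[\pi/2,x_0]$, $\phi\in[0,f(\chi)/2]$, $\lambda\in[0,\sin\chi/\cos\phi]$: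 as long as no exit has been reported to it, $R_2$ moves at unit speed as follows. During $[0,1]$ it walks straight from $O$ to $A$. Then it walks along the circle through the points $P(s)$, $s$ increasing from $0$ to $\chi$, reaching $B=P(\chi)$ (pre-detour phase). Detour phase: it walks distance $\lambda$ from $B$ in direction $(-\cos\phi,\sin\phi)$ to $G=(\sin\chi-\lambda\cos\phi,\ \cos\chi+\lambda\sin\phi)$; then walks horizontally to $C=(0,\cos\chi+\lambda\sin\phi)$ on the diameter $AA'$; then walks straight back from $C$ to $B$. Post-detour phase: it walks along the circle through $P(s)$, $s$ increasing from $\chi$ to $\pi$, reaching $A'$. Simultaneously $R_1$ follows the mirror image of this trajectory under $(x,y)\mapsto(-x,y)$. A robot that finds the exit follows the meeting protocol. *)

(* Defs.v *)
From Stdlib Require Import Reals.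
From Coquelicot Require Import Coquelicot.

Open Scope R_scope.

Definition point : Type := (R * R)%type.

Definition dist (p q : point) : R := dist_euc (fst p) (snd p) (fst q) (snd q).

Definition on_circle (p : point) : Prop := (fst p)² + (snd p)² = 1.

(** Unit-speed walk along the segment [pq], seen after [s] units of time; the
    walker waits at [q] once arrived.  If [p = q], the coefficient
    [Rmin s 0 / 0] is irrelevant because it multiplies [0]. *)
Definition walk (p q : point) (s : R) : point :=
  let k := Rmin s (dist p q) / dist p q in
  (fst p + k * (fst q - fst p), snd p + k * (snd q - snd p)).

(** Position as a function of time; only times [t >= 0] are meaningful. *)
Definition trajectory : Type := R -> point.

Definition is_least (S : R -> Prop) (m : R) : Prop :=
  S m /\ forall t, S t -> m <= t.

Section Evacuation.

(** Prescribed trajectories of the two robots, followed as long as no exit has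
    been found by, or reported to, the robot. *)
Variables p1 p2 : trajectory.

Definition discovery_time (X : point) (t0 : R) : Prop :=
  is_least (fun t => 0 <= t /\ (p1 t = X \/ p2 t = X)) t0.

(** [q] is the prescribed trajectory of the robot that did not find the exit;
    [t] is the duration between the discovery and the meeting. *)
Definition meeting_delay (q : trajectory) (X : point) (t0 t : R) : Prop :=
  is_least (fun u => 0 <= u /\ dist X (q (t0 + u)) = u) t.

(** Actual motions under the meeting protocol of the finder (prescribed
    trajectory [p]) and of the other robot (prescribed trajectory [q]); the
    meeting point is [q (t0 + t)]. *)
Definition finder_motion (p q : trajectory) (X : point) (t0 t : R) : trajectory :=
  fun s =>
    if Rle_dec s t0 then p s
    else if Rle_dec s (t0 + t) then walk X (q (t0 + t)) (s - t0)
    else walk (q (t0 + t)) X (s - (t0 + t)).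

Definition other_motion (q : trajectory) (X : point) (t0 t : R) : trajectory :=
  fun s =>
    if Rle_dec s (t0 + t) then q s
    else walk (q (t0 + t)) X (s - (t0 + t)).

(** [r1], [r2] are the actual motions of the robots when the exit is at [X].
    If both find the exit simultaneously, then [t = 0] and both cases agree. *)
Definition execution (X : point) (r1 r2 : trajectory) : Prop :=
  exists t0 t : R,
    discovery_time X t0 /\
    ((p1 t0 = X /\ meeting_delay p2 X t0 t /\
      r1 = finder_motion p1 p2 X t0 t /\ r2 = other_motion p2 X t0 t) \/
     (p2 t0 = X /\ meeting_delay p1 X t0 t /\
      r2 = finder_motion p2 p1 X t0 t /\ r1 = other_motion p1 X t0 t)).

Definition reached_by (r : trajectory) (X : point) (T : R) : Prop :=
  exists s : R, 0 <= s <= T /\ r s = X.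

(** [p_infty] if the robots never evacuate. *)
Definition evacuation_time_at (X : point) : Rbar :=
  Glb_Rbar (fun T => exists r1 r2 : trajectory,
    execution X r1 r2 /\ reached_by r1 X T /\ reached_by r2 X T).

Definition evacuation_time : Rbar :=
  Rbar_lub (fun T => exists X : point, on_circle X /\ T = evacuation_time_at X).

End Evacuation.

(** Boundary point at clockwise arc distance [s] from [(0, 1)]. *)
Definition arc (s : R) : point := (sin s, cos s).

Definition mirror (p : point) : point := (- fst p, snd p).

(** The point at distance [s] from [arc chi] on the first leg of the detour. *)
Definition detour_leg (chi phi s : R) : point :=
  (sin chi - s * cos phi, cos chi + s * sin phi).

(** Trajectory of the second robot in the algorithm with parameters [chi],
    [phi], [lam], intended for [PI / 2 <= chi <= x0],
    [0 <= phi <= f chi / 2] and [0 <= lam <= sin chi / cos phi], where [f x] is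
    the [z] with [z = 2 * sin (x - z / 2)] and [x0] (about 2.85344) maximizes
    [x + f x] on [[0, PI]].  The robot stays at [(0, -1)] at the end. *)
Definition traj2 (chi phi lam : R) : trajectory := fun t =>
  let b := arc chi in
  let g := detour_leg chi phi lam in
  let c := (0, cos chi + lam * sin phi) in
  let t_a := 1 in
  let t_b := t_a + chi in
  let t_g := t_b + lam in
  let t_c := t_g + dist g c in
  let t_b' := t_c + dist c b in
  if Rle_dec t t_a then walk (0, 0) (0, 1) t
  else if Rle_dec t t_b then arc (t - t_a)
  else if Rle_dec t t_g then detour_leg chi phi (t - t_b)
  else if Rle_dec t t_c then walk g c (t - t_g)
  else if Rle_dec t t_b' then walk c b (t - t_c)
  else arc (Rmin (chi + (t - t_b')) PI).

Definition traj1 (chi phi lam : R) : trajectory :=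
  fun t => mirror (traj2 chi phi lam t).

Definition algorithm_evacuation_time (chi phi lam : R) : Rbar :=
  evacuation_time (traj1 chi phi lam) (traj2 chi phi lam).

(* Main.v *)
(** At time [t] an exit finder knows that the other robot will be at the mirror
    image of [p ((T + t) / 2)] halfway through the remaining time [T - t]; if that
    point is within distance [(T - t) / 2], the robots meet early enough to be back
    by time [T], since distance minus elapsed time changes sign before then.  So the
    theorem reduces to the single inequality
    [dist (p t) (mirror (p ((T + t) / 2))) <= (T - t) / 2] at the times when [p t]
    lies on the circle.  It is checked separately on each part of the trajectory
    that the meeting time can fall in.  When both robots are on the circle the
    distance is [2 * sin] of half their arc distance, and the concavity of the sine
    makes the inequality linear; on the two outgoing detour legs and at the end of
    the detour the slack is only about [3e-5], so Taylor enclosures of the sines and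
    cosines of the parameters are needed. *)

Require Import Defs.
From Stdlib Require Import Reals.
From Coquelicot Require Import Coquelicot.
From Stdlib Require Import Lra Classical Factorial.
Import Defs.
Open Scope R_scope.

(** * The meeting protocol for mirror-symmetric trajectories *)

Lemma dist_sq (p q : point) :
  dist p q = sqrt ((fst p - fst q)² + (snd p - snd q)²).
Proof. reflexivity. Qed.

Lemma dist_nonneg (p q : point) : 0 <= dist p q.
Proof. apply sqrt_pos. Qed.

Lemma dist_le (p q : point) (d : R) :
  0 <= d -> (fst p - fst q) ^ 2 + (snd p - snd q) ^ 2 <= d ^ 2 -> dist p q <= d.
Proof.
  intros Hd H; rewrite dist_sq, <- (sqrt_pow2 d Hd).
  apply sqrt_le_1_alt; unfold Rsqr; lra.
Qed.

Lemma dist_sym (p q : point) : dist p q = dist q p.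
Proof. apply distance_symm. Qed.

Lemma dist_mirror (p q : point) : dist (mirror p) (mirror q) = dist p q.
Proof. rewrite !dist_sq; f_equal; unfold Rsqr; simpl; ring. Qed.

Lemma mirror_mirror (p : point) : mirror (mirror p) = p.
Proof. destruct p; unfold mirror; simpl; now rewrite Ropp_involutive. Qed.

Lemma dist_eq0 (p q : point) : dist p q = 0 <-> p = q.
Proof.
  destruct p as [a b], q as [c d]; split; intros H.
  - rewrite dist_sq in H; apply sqrt_eq_0 in H; simpl in *.
    + destruct (Rplus_sqr_eq_0 _ _ H); f_equal; lra.
    + apply Rplus_le_le_0_compat; apply Rle_0_sqr.
  - injection H as -> ->; apply distance_refl.
Qed.

Lemma dist_pos (p q : point) : p <> q -> 0 < dist p q.
Proof.
  intros H; destruct (Rle_lt_or_eq_dec _ _ (dist_nonneg p q)) as [|E]; auto.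
  now destruct H; apply dist_eq0.
Qed.

Lemma walk_end (p q : point) (s : R) : dist p q <= s -> walk p q s = q.
Proof.
  intros H; unfold walk; rewrite Rmin_right by auto.
  destruct (classic (p = q)) as [->|N].
  - destruct q; simpl; f_equal; ring.
  - assert (P := dist_pos _ _ N); destruct p, q; simpl; f_equal; field; lra.
Qed.

(** * Continuity of paths and existence of first meeting times *)

Definition continuous_path (p : trajectory) : Prop :=
  continuity (fun t => fst (p t)) /\ continuity (fun t => snd (p t)).

Lemma continuity_dist (X : point) (p : trajectory) :
  continuous_path p -> continuity (fun t => dist X (p t)).
Proof.
  intros [H1 H2] t.
  apply (continuity_pt_comp
    (fun t => (fst X - fst (p t))² + (snd X - snd (p t))²) sqrt).
  - apply continuity_pt_plus;
      (apply (continuity_pt_comp _ Rsqr);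
       [|apply derivable_continuous; apply derivable_Rsqr]);
      (apply continuity_pt_minus;
       [now apply continuity_pt_const; intros ? ?|auto]).
  - apply continuity_pt_sqrt, Rplus_le_le_0_compat; apply Rle_0_sqr.
Qed.

Lemma continuous_path_mirror (p : trajectory) :
  continuous_path p -> continuous_path (fun t => mirror (p t)).
Proof.
  intros [H1 H2]; split; intros t; simpl; auto.
  apply continuity_pt_opp, H1.
Qed.

Lemma continuity_pt_nonzero (f : R -> R) (x : R) :
  continuity_pt f x -> f x <> 0 ->
  exists e, 0 < e /\ forall y, Rabs (y - x) < e -> f y <> 0.
Proof.
  intros C N.
  destruct (C (Rabs (f x)) (Rabs_pos_lt _ N)) as [e [He H]].
  exists e; split; auto; intros y Hy E.
  destruct (Req_dec y x) as [->|D]; [auto|].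
  specialize (H y); simpl in H; unfold Rdist in H.
  rewrite E, Rminus_0_l, Rabs_Ropp in H.
  apply (Rlt_irrefl (Rabs (f x))), H; repeat split; auto.
Qed.

(** The least zero is the supremum of all [l] such that [f] has no zero on [[0, l)]. Were [f]
    nonzero at this supremum, continuity would keep it nonzero a little beyond. *)
Lemma least_zero (f : R -> R) (t1 : R) :
  continuity f -> 0 <= t1 -> f t1 = 0 ->
  exists m, is_least (fun t => 0 <= t /\ f t = 0) m /\ m <= t1.
Proof.
  intros C P Z.
  pose (E := fun l => forall t, 0 <= t < l -> f t <> 0).
  assert (B : is_upper_bound E t1).
  { intros l Hl; apply Rnot_lt_le; intros L; apply (Hl t1); auto. }
  destruct (completeness E) as [m [U L]].
  { now exists t1. }
  { exists 0; intros t Ht; lra. }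
  assert (m0 : 0 <= m) by (apply U; intros t Ht; lra).
  assert (below : forall t, 0 <= t -> f t = 0 -> m <= t).
  { intros t Ht F; apply L; intros l Hl; apply Rnot_lt_le; intros Q.
    now apply (Hl t). }
  assert (F : f m = 0).
  { apply NNPP; intros N.
    destruct (continuity_pt_nonzero f m (C m) N) as [e [He H]].
    assert (m + e / 2 <= m); [|lra].
    apply U; intros t Ht F; specialize (below t (proj1 Ht) F).
    apply (H t); auto; rewrite Rabs_right; lra. }
  exists m; repeat split; auto; intros t [? ?]; auto.
Qed.

(** Distance minus elapsed time is nonnegative at delay 0 and nonpositive at delay [(T - t0) / 2],
    so it vanishes in between; the least zero comes no later. *)
Lemma meeting_delay_exists (q : trajectory) (X : point) (t0 T : R) :
  continuous_path q -> t0 <= T -> dist X (q ((T + t0) / 2)) <= (T - t0) / 2 ->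
  exists u, meeting_delay q X t0 u /\ t0 + 2 * u <= T.
Proof.
  intros C L D.
  pose (f := fun u => dist X (q (t0 + u)) - u).
  assert (Cf : continuity f).
  { intros u; apply continuity_pt_minus; [|apply continuity_pt_id].
    apply (continuity_pt_comp (fun u => t0 + u) (fun t => dist X (q t))).
    - apply continuity_pt_plus;
        [now apply continuity_pt_const; intros ? ?|apply continuity_pt_id].
    - now apply continuity_dist. }
  destruct (IVT_cor f 0 ((T - t0) / 2) Cf) as [z [Hz Fz]]; [lra| |].
  { assert (0 <= f 0) by (unfold f; generalize (dist_nonneg X (q (t0 + 0))); lra).
    assert (f ((T - t0) / 2) <= 0); [|nra].
    unfold f; replace (t0 + (T - t0) / 2) with ((T + t0) / 2) by field; lra. }
  destruct (least_zero f z Cf) as [m [[[m0 Fm] M] Lm]]; [lra|auto|].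
  exists m; split; [|lra].
  unfold f in *; split; [lra|].
  intros t [Ht Et]; apply M; lra.
Qed.

Lemma other_reaches (q : trajectory) (X : point) (t0 u T : R) :
  meeting_delay q X t0 u -> 0 <= t0 -> t0 + 2 * u <= T ->
  reached_by (other_motion q X t0 u) X T.
Proof.
  intros [[u0 D] _] P L; exists (t0 + 2 * u); split; [lra|].
  unfold other_motion; destruct Rle_dec.
  (* Here [t0 + 2 * u <= t0 + u]: both robots are at the exit at time [t0]. *)
  - assert (u = 0) as -> by lra.
    apply dist_eq0 in D; simpl; rewrite D; f_equal; ring.
  - apply walk_end; rewrite dist_sym, D; lra.
Qed.

Lemma finder_reaches (p q : trajectory) (X : point) (t0 u T : R) :
  p t0 = X -> 0 <= t0 <= T -> reached_by (finder_motion p q X t0 u) X T.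
Proof.
  intros H P; exists t0; split; auto.
  unfold finder_motion; destruct Rle_dec; [auto|lra].
Qed.

(** Reduces the bound to conditions on the prescribed path [p] alone; by mirror symmetry one
    inequality serves whichever robot is the finder. *)
Lemma evacuation_time_le (p : trajectory) (T tend : R) :
  continuous_path p -> tend <= T ->
  (forall X, on_circle X -> exists t, 0 <= t <= tend /\ (mirror (p t) = X \/ p t = X)) ->
  (forall t, 0 <= t <= tend -> on_circle (p t) ->
     dist (p t) (mirror (p ((T + t) / 2))) <= (T - t) / 2) ->
  Rbar_le (evacuation_time (fun t => mirror (p t)) p) T.
Proof.
  intros C L V K; unfold evacuation_time, Rbar_lub.
  destruct Rbar_ex_lub as [l [Ul Hl]]; simpl; apply Hl.
  intros v [X [HX ->]].
  unfold evacuation_time_at, Glb_Rbar.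
  destruct ex_glb_Rbar as [g [Hg Lg]]; simpl; apply Hg.
  assert (C' := continuous_path_mirror p C).
  destruct (V X HX) as [t1 [Ht1 E1]].
  (* The product of the two distances vanishes exactly when some robot is at [X], so its least zero
     is the discovery time. *)
  destruct (least_zero (fun t => dist X (mirror (p t)) * dist X (p t)) t1)
    as [t0 [[[P0 Z0] M0] L0]]; [| lra | |].
  { intros t; apply (continuity_pt_mult (fun t => dist X (mirror (p t))));
      now apply continuity_dist. }
  { apply Rmult_eq_0_compat; rewrite !dist_eq0; intuition. }
  assert (D : discovery_time (fun t => mirror (p t)) p X t0).
  { split.
    - split; auto; apply Rmult_integral in Z0; rewrite !dist_eq0 in Z0; intuition.
    - intros t [Ht E]; apply M0; split; auto.
      apply Rmult_eq_0_compat; rewrite !dist_eq0; intuition. }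
  destruct D as [[_ E] D'].
  assert (on_circle (p t0)).
  { destruct E as [E|E]; rewrite <- E in HX; auto.
    unfold on_circle in *; simpl in HX; now rewrite <- Rsqr_neg in HX. }
  assert (K0 := K t0 (conj P0 (Rle_trans _ _ _ L0 (proj2 Ht1))) H).
  destruct E as [E|E].
  - destruct (meeting_delay_exists p X t0 T) as [u [Hu Lu]]; [auto|lra| |].
    { now rewrite <- E, <- dist_mirror, mirror_mirror. }
    exists (finder_motion (fun t => mirror (p t)) p X t0 u), (other_motion p X t0 u).
    repeat split.
    + exists t0, u; split; [split; auto|left; auto].
    + apply finder_reaches; auto; lra.
    + now apply other_reaches.
  - destruct (meeting_delay_exists (fun t => mirror (p t)) X t0 T)
      as [u [Hu Lu]]; [auto|lra|now rewrite <- E|].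
    exists (other_motion (fun t => mirror (p t)) X t0 u),
      (finder_motion p (fun t => mirror (p t)) X t0 u).
    repeat split.
    + exists t0, u; split; [split; auto|right; auto].
    + now apply other_reaches.
    + apply finder_reaches; auto; lra.
Qed.

(** * The prescribed trajectory *)

Lemma continuity_glue (f g : R -> R) (a : R) :
  continuity f -> continuity g -> f a = g a ->
  continuity (fun t => if Rle_dec t a then f t else g t).
Proof.
  intros Cf Cg E x eps He.
  destruct (Cf x eps He) as [d1 [P1 H1]], (Cg x eps He) as [d2 [P2 H2]].
  simpl in *; unfold Rdist in *.
  (* Away from [a], the radius [Rabs (x - a)] keeps [t] on the same side of [a] as [x]; at [x = a]
     both branches agree and any radius will do. *)
  exists (Rmin (Rmin d1 d2) (if Req_dec_T x a then 1 else Rabs (x - a))).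
  split.
  { repeat apply Rmin_pos; auto; destruct Req_dec_T; [lra|].
    apply Rabs_pos_lt; lra. }
  intros t [Dt Ht].
  assert (B1 := Rlt_le_trans _ _ _ Ht (Rmin_l _ _)).
  assert (B2 := Rlt_le_trans _ _ _ Ht (Rmin_r _ _)).
  assert (B3 := Rlt_le_trans _ _ _ B1 (Rmin_l _ _)).
  assert (B4 := Rlt_le_trans _ _ _ B1 (Rmin_r _ _)).
  specialize (H1 t (conj Dt B3)); specialize (H2 t (conj Dt B4)).
  destruct (Rle_dec t a), (Rle_dec x a), (Req_dec_T x a); subst; auto; try lra;
    try (now rewrite E);
    exfalso; revert B2; unfold Rabs; repeat destruct Rcase_abs; lra.
Qed.

Lemma continuous_path_glue (f g : trajectory) (a : R) :
  continuous_path f -> continuous_path g -> f a = g a ->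
  continuous_path (fun t => if Rle_dec t a then f t else g t).
Proof.
  intros [F1 F2] [G1 G2] E; split.
  - assert (H := continuity_glue _ _ a F1 G1 (f_equal fst E)).
    intros t; generalize (H t); apply continuity_pt_ext; intros s.
    now destruct Rle_dec.
  - assert (H := continuity_glue _ _ a F2 G2 (f_equal snd E)).
    intros t; generalize (H t); apply continuity_pt_ext; intros s.
    now destruct Rle_dec.
Qed.

Lemma continuous_path_shift (p : trajectory) (a : R) :
  continuous_path p -> continuous_path (fun t => p (t - a)).
Proof.
  intros [H1 H2]; split; intros t;
    [apply (continuity_pt_comp (fun t => t - a) (fun t => fst (p t)))
    |apply (continuity_pt_comp (fun t => t - a) (fun t => snd (p t)))]; auto; reg.
Qed.

Lemma continuity_Rmin_r (a : R) : continuity (fun t => Rmin t a).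
Proof.
  apply (continuity_glue (fun t => t) (fun _ => a)); auto; intros t; reg.
Qed.

Lemma continuous_path_walk (p q : point) : continuous_path (walk p q).
Proof.
  assert (H : continuity (fun t => Rmin t (dist p q) / dist p q)).
  { intros t; apply continuity_pt_mult; [apply continuity_Rmin_r|].
    now apply continuity_pt_const; intros ? ?. }
  split; intros t; unfold walk; cbv zeta; simpl;
    (apply continuity_pt_plus; [now apply continuity_pt_const; intros ? ?|]);
    (apply continuity_pt_mult; [apply H|now apply continuity_pt_const; intros ? ?]).
Qed.

Lemma walk_start (p q : point) : walk p q 0 = p.
Proof.
  unfold walk; rewrite Rmin_left by apply dist_nonneg.
  destruct p; simpl; unfold Rdiv; f_equal; ring.
Qed.

Lemma continuous_path_arc (f : R -> R) :
  continuity f -> continuous_path (fun t => arc (f t)).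
Proof.
  intros H; split; intros t; simpl;
    [apply (continuity_pt_comp f sin)|apply (continuity_pt_comp f cos)]; auto;
    [apply continuity_sin|apply continuity_cos].
Qed.

Lemma detour_leg_0 (chi phi : R) : detour_leg chi phi 0 = arc chi.
Proof. unfold detour_leg, arc; f_equal; ring. Qed.

(** * Lengths of the detour legs and closed forms of the trajectory on each phase *)

Definition centre_leg (chi phi lam : R) : R :=
  dist (detour_leg chi phi lam) (0, cos chi + lam * sin phi).

Definition return_leg (chi phi lam : R) : R :=
  dist (0, cos chi + lam * sin phi) (arc chi).

Definition detour_end (chi phi lam : R) : R :=
  1 + chi + lam + centre_leg chi phi lam + return_leg chi phi lam.

Lemma traj2_continuous (chi phi lam : R) :
  0 <= chi <= PI -> 0 <= lam -> continuous_path (traj2 chi phi lam).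
Proof.
  intros Hc Hl; unfold traj2; cbv zeta.
  set (g := detour_leg chi phi lam); set (c := (0, cos chi + lam * sin phi)).
  assert (D2 := dist_nonneg g c); assert (D3 := dist_nonneg c (arc chi)).
  apply continuous_path_glue; [apply continuous_path_walk| |].
  apply continuous_path_glue; [apply continuous_path_arc; intros t; reg| |].
  apply continuous_path_glue.
  { split; intros t; unfold detour_leg; simpl; reg. }
  apply continuous_path_glue.
  { apply (continuous_path_shift (walk g c)), continuous_path_walk. }
  apply continuous_path_glue.
  { apply (continuous_path_shift (walk c (arc chi))), continuous_path_walk. }
  { apply continuous_path_arc; intros t.
    apply (continuity_pt_comp
      (fun t => chi + (t - (1 + chi + lam + dist g c + dist c (arc chi))))
      (fun s => Rmin s PI)); [reg|apply continuity_Rmin_r]. }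
  (* What remains is agreement at the breakpoints, from the last one back to the first. *)
  - rewrite walk_end by lra; f_equal.
    rewrite Rmin_left; lra.
  - rewrite walk_end by lra.
    destruct Rle_dec; [|lra]; now rewrite Rminus_diag, walk_start.
  - destruct Rle_dec; [|lra]; rewrite Rminus_diag, walk_start.
    unfold g; f_equal; ring.
  - destruct Rle_dec; [|lra]; rewrite Rminus_diag, detour_leg_0; f_equal; ring.
  - destruct Rle_dec; [|lra]; rewrite walk_end.
    + unfold arc; rewrite Rminus_diag, sin_0, cos_0; reflexivity.
    + rewrite dist_sq; simpl; unfold Rsqr.
      replace (_ + _) with 1 by ring; rewrite sqrt_1; lra.
Qed.

Lemma centre_leg_eq (chi phi lam : R) :
  0 <= sin chi - lam * cos phi -> centre_leg chi phi lam = sin chi - lam * cos phi.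
Proof.
  intros H; unfold centre_leg; rewrite dist_sq; simpl.
  rewrite Rminus_diag, Rsqr_0, Rplus_0_r, Rminus_0_r; now apply sqrt_Rsqr.
Qed.

Lemma return_leg_eq (chi phi lam : R) :
  return_leg chi phi lam = sqrt ((sin chi)² + (lam * sin phi)²).
Proof.
  unfold return_leg; rewrite dist_sq; f_equal; simpl; unfold Rsqr; ring.
Qed.

Lemma return_leg_pos (chi phi lam : R) : 0 < sin chi -> 0 < return_leg chi phi lam.
Proof.
  intros H; rewrite return_leg_eq; apply sqrt_lt_R0.
  assert (P := Rlt_0_sqr (sin chi) ltac:(lra)).
  assert (Q := Rle_0_sqr (lam * sin phi)); lra.
Qed.

Lemma traj2_inward (chi phi lam t : R) :
  0 <= t <= 1 -> traj2 chi phi lam t = (0, t).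
Proof.
  intros H; unfold traj2; cbv zeta; destruct Rle_dec; [|lra].
  assert (D : dist (0, 0) (0, 1) = 1).
  { rewrite dist_sq; simpl; unfold Rsqr.
    replace (_ + _) with 1 by ring; apply sqrt_1. }
  unfold walk; rewrite D, Rmin_left by lra; simpl; f_equal; field.
Qed.

Lemma traj2_pre_detour (chi phi lam t : R) :
  1 <= t <= 1 + chi -> traj2 chi phi lam t = arc (t - 1).
Proof.
  intros H; destruct (Req_dec t 1) as [->|N].
  - rewrite traj2_inward by lra; unfold arc.
    now rewrite Rminus_diag, sin_0, cos_0.
  - unfold traj2; cbv zeta; repeat (destruct Rle_dec; [try lra|try lra]); auto.
Qed.

Lemma traj2_first_leg (chi phi lam t : R) :
  0 <= chi -> 1 + chi < t <= 1 + chi + lam ->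
  traj2 chi phi lam t = detour_leg chi phi (t - (1 + chi)).
Proof.
  intros Hc H; unfold traj2; cbv zeta.
  do 3 (destruct Rle_dec; [try lra|try lra]); auto.
Qed.

Lemma traj2_centre_leg (chi phi lam t : R) :
  0 <= chi -> 0 <= lam -> 0 < sin chi - lam * cos phi ->
  1 + chi + lam < t <= 1 + chi + lam + centre_leg chi phi lam ->
  traj2 chi phi lam t =
  (sin chi - lam * cos phi - (t - (1 + chi + lam)), cos chi + lam * sin phi).
Proof.
  intros Hc Hl Hs H; unfold traj2; cbv zeta; fold (centre_leg chi phi lam).
  do 4 (destruct Rle_dec; [try lra|try lra]).
  unfold walk; fold (centre_leg chi phi lam); rewrite Rmin_left by lra.
  rewrite centre_leg_eq by lra; unfold detour_leg; simpl; f_equal; field; lra.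
Qed.

Lemma traj2_return_leg (chi phi lam t : R) :
  0 <= chi -> 0 <= lam -> 0 < sin chi ->
  1 + chi + lam + centre_leg chi phi lam < t <= detour_end chi phi lam ->
  traj2 chi phi lam t =
  let d := (detour_end chi phi lam - t) / return_leg chi phi lam in
  (sin chi - d * sin chi, cos chi + d * (lam * sin phi)).
Proof.
  intros Hc Hl Hs H; unfold detour_end, traj2 in *; cbv zeta.
  fold (centre_leg chi phi lam); fold (return_leg chi phi lam).
  assert (D2 := dist_nonneg (detour_leg chi phi lam) (0, cos chi + lam * sin phi)).
  fold (centre_leg chi phi lam) in D2.
  do 5 (destruct Rle_dec; [try lra|try lra]).
  assert (P := return_leg_pos chi phi lam Hs).
  unfold walk; fold (return_leg chi phi lam); rewrite Rmin_left by lra.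
  unfold arc; simpl; f_equal; field; lra.
Qed.

Lemma traj2_post_detour (chi phi lam t : R) :
  0 <= chi <= PI -> 0 <= lam -> 0 < sin chi -> detour_end chi phi lam <= t ->
  traj2 chi phi lam t = arc (Rmin (chi + (t - detour_end chi phi lam)) PI).
Proof.
  intros Hc Hl Hs H.
  assert (D2 := dist_nonneg (detour_leg chi phi lam) (0, cos chi + lam * sin phi)).
  fold (centre_leg chi phi lam) in D2.
  assert (P := return_leg_pos chi phi lam Hs).
  destruct (Req_dec t (detour_end chi phi lam)) as [E|N].
  - rewrite traj2_return_leg by (try unfold detour_end in *; lra).
    rewrite E; cbv zeta; rewrite Rminus_diag, Rmin_left by lra.
    unfold arc, Rdiv; f_equal; [|]; rewrite ?Rplus_0_r; ring.
  - unfold detour_end, traj2 in *; cbv zeta.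
    fold (centre_leg chi phi lam); fold (return_leg chi phi lam).
    repeat (destruct Rle_dec; [try lra|try lra]); auto.
Qed.

(** The line of the first leg cuts from the circle a chord of length
    [2 * sin (chi - phi)], so the detour stays inside the disk when [lam] is
    smaller. *)
Lemma traj2_on_circle (chi phi lam t : R) :
  0 <= chi -> 0 <= lam -> 0 < sin chi - lam * cos phi -> 0 <= cos phi ->
  lam < 2 * sin (chi - phi) -> 0 <= t -> on_circle (traj2 chi phi lam t) ->
  1 <= t <= 1 + chi \/ detour_end chi phi lam <= t.
Proof.
  intros Hc Hl Hs Hp Hg Ht H.
  assert (I := sin2_cos2 chi); assert (Q := sin2_cos2 phi).
  rewrite sin_minus in Hg.
  assert (Hs' : 0 < sin chi) by nra.
  assert (P := return_leg_pos chi phi lam Hs').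
  unfold on_circle in H.
  set (S := sin chi) in *; set (C := cos chi) in *.
  set (s := sin phi) in *; set (c := cos phi) in *.
  destruct (Rle_lt_dec 1 t).
  2: { rewrite traj2_inward in H by lra; simpl in H; unfold Rsqr in H; nra. }
  destruct (Rle_lt_dec t (1 + chi)); [now left|].
  destruct (Rle_lt_dec t (1 + chi + lam)).
  { rewrite traj2_first_leg in H by lra; unfold detour_leg in H; simpl in H.
    fold S C s c in H; unfold Rsqr in *; exfalso.
    (* The squared norm is [1 + w * (w - 2 * sin (chi - phi))], hence below 1. *)
    set (w := t - (1 + chi)) in *; assert (0 < w <= lam) by (unfold w; lra).
    nra. }
  assert (E := centre_leg_eq chi phi lam ltac:(fold S c; lra)); fold S c in E.
  right; apply Rnot_lt_le; intros L.
  destruct (Rle_lt_dec t (1 + chi + lam + centre_leg chi phi lam)).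
  { rewrite traj2_centre_leg in H by (auto; lra); simpl in H.
    fold S C s c in H; unfold Rsqr in *.
    set (w := t - (1 + chi + lam)) in *.
    assert (0 < w <= S - lam * c) by (unfold w; lra).
    (* Walking towards the axis at constant ordinate strictly decreases the norm, which is at most 1
       at the end of the first leg. *)
    assert ((S - lam * c - w) * (S - lam * c - w) < (S - lam * c) * (S - lam * c)) by nra.
    assert ((S - lam * c) * (S - lam * c) + (C + lam * s) * (C + lam * s) <= 1) by nra.
    lra. }
  rewrite traj2_return_leg in H by (auto; lra); cbv zeta in H; simpl in H.
  fold S C s in H; unfold Rsqr in *.
  set (d := _ / return_leg chi phi lam) in *.
  assert (0 < d < 1).
  { unfold d, detour_end in *; split.
    - apply Rdiv_lt_0_compat; lra.
    - apply (Rmult_lt_reg_r (return_leg chi phi lam)); auto.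
      unfold Rdiv; rewrite Rmult_assoc, Rinv_l, Rmult_1_r, Rmult_1_l; lra. }
  assert ((C + lam * s) * (C + lam * s) < 1) by nra.
  set (y := C + lam * s) in *.
  assert (0 <= d * (1 - d) * (S * S + (C - y) * (C - y))).
  { apply Rmult_le_pos; [nra|apply Rplus_le_le_0_compat; apply Rle_0_sqr]. }
  (* Strict convexity of the squared norm along the segment, whose endpoints have norms 1 and less
     than 1. *)
  assert ((S - d * S) * (S - d * S) + (C + d * (lam * s)) * (C + d * (lam * s))
    = (1 - d) * (S * S + C * C) + d * (y * y)
      - d * (1 - d) * (S * S + (C - y) * (C - y))) by (unfold y; ring).
  nra.
Qed.

(** * Trigonometric enclosures *)

Lemma INR_fact_S (n : nat) :
  INR (fact (S n)) = IZR (Z.of_nat (S n)) * INR (fact n).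
Proof. now rewrite fact_simpl, mult_INR, (INR_IZR_INZ (S n)). Qed.

(** The alternating Taylor sums of degrees 15 and 17, in Horner form so that [lra] can evaluate them
    at a rational argument. *)
Lemma sin_taylor (x : R) : 0 <= x <= 3 ->
  x * (1 - x^2/6 * (1 - x^2/20 * (1 - x^2/42 * (1 - x^2/72 * (1 - x^2/110 *
    (1 - x^2/156 * (1 - x^2/210))))))) <= sin x <=
  x * (1 - x^2/6 * (1 - x^2/20 * (1 - x^2/42 * (1 - x^2/72 * (1 - x^2/110 *
    (1 - x^2/156 * (1 - x^2/210 * (1 - x^2/272)))))))).
Proof.
  intros H; assert (P := PI2_3_2).
  destruct (sin_bound x 3) as [L U]; [lra|lra|].
  unfold sin_approx, sin_term in L, U.
  simpl Nat.add in L, U; simpl Nat.mul in L, U.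
  cbn [sum_f_R0 Nat.add Nat.mul] in L, U.
  repeat rewrite INR_fact_S in L; repeat rewrite INR_fact_S in U.
  simpl Z.of_nat in L, U; change (INR (fact 0)) with 1 in L, U.
  split; [refine (Rle_trans _ _ _ _ L)|refine (Rle_trans _ _ _ U _)];
    apply Req_le; lra.
Qed.

(** Lets sine enclosures alone yield the cosine enclosures. *)
Lemma cos_half (x : R) : cos x = 1 - 2 * (sin (x / 2)) ^ 2.
Proof.
  replace x with (2 * (x / 2)) at 1 by field.
  rewrite cos_2a_sin; ring.
Qed.


Lemma sin_enclosure (x l u : R) : 0 <= x <= 3 ->
  l <= x * (1 - x^2/6 * (1 - x^2/20 * (1 - x^2/42 * (1 - x^2/72 * (1 - x^2/110 *
    (1 - x^2/156 * (1 - x^2/210))))))) ->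
  x * (1 - x^2/6 * (1 - x^2/20 * (1 - x^2/42 * (1 - x^2/72 * (1 - x^2/110 *
    (1 - x^2/156 * (1 - x^2/210 * (1 - x^2/272)))))))) <= u ->
  l <= sin x <= u.
Proof. intros H L U; destruct (sin_taylor x H); lra. Qed.

Lemma cos_enclosure (x l u : R) :
  0 <= l -> l <= sin (x / 2) <= u -> 1 - 2 * u ^ 2 <= cos x <= 1 - 2 * l ^ 2.
Proof. intros Hl H; rewrite (cos_half x); nra. Qed.

Ltac sin_bounds := apply sin_enclosure; lra.

Lemma sin_chi : 0.4879394 <= sin 2.631865 <= 0.4879397.
Proof. sin_bounds. Qed.

Lemma cos_chi : -0.8728777 <= cos 2.631865 <= -0.8728772.
Proof.
  assert (H := cos_enclosure 2.631865 0.96769758 0.96769766 ltac:(lra)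
    ltac:(sin_bounds)); lra.
Qed.

Lemma sin_phi : 0.4342089 <= sin 0.44916 <= 0.4342091.
Proof. sin_bounds. Qed.

Lemma cos_phi : 0.9008120 <= cos 0.44916 <= 0.9008123.
Proof.
  assert (H := cos_enclosure 0.44916 0.2226969 0.222697 ltac:(lra)
    ltac:(sin_bounds)); lra.
Qed.

(** Low-degree bounds for a variable argument: they turn the later inequalities into polynomial
    ones. *)
Lemma sin_small (v : R) : 0 <= v <= 3 -> v - v^3/6 <= sin v <= v.
Proof.
  intros H; assert (P := PI2_3_2).
  destruct (sin_bound v 0) as [L U]; [lra|lra|].
  unfold sin_approx, sin_term in L; simpl in L.
  split; [lra|].
  destruct (Req_dec v 0) as [->|N]; [rewrite sin_0; lra|].
  apply Rlt_le, sin_lt_x; lra.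
Qed.

Lemma cos_small (v : R) : -3/2 <= v <= 3/2 -> 1 - v^2/2 <= cos v <= 1 - v^2/2 + v^4/24.
Proof.
  intros H; assert (P := PI2_3_2).
  destruct (cos_bound v 0) as [L U]; [lra|lra|].
  unfold cos_approx, cos_term in L, U; simpl in L, U; lra.
Qed.

(** Concavity: by the mean value theorem the secant slope is some [cos c], and cosine decreases on
    [[0, PI]]. *)
Lemma sin_le_tangent (w w0 : R) : 0 <= w <= PI -> 0 <= w0 <= PI ->
  sin w <= sin w0 + cos w0 * (w - w0).
Proof.
  intros Hw H0.
  destruct (Rtotal_order w w0) as [L|[->|L]]; [| lra |].
  - destruct (MVT_cor2 sin cos w w0 L) as [c [E Hc]].
    { intros; apply derivable_pt_lim_sin. }
    assert (cos w0 <= cos c) by (apply cos_decr_1; lra); nra.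
  - destruct (MVT_cor2 sin cos w0 w L) as [c [E Hc]].
    { intros; apply derivable_pt_lim_sin. }
    assert (cos c <= cos w0) by (apply cos_decr_1; lra); nra.
Qed.

(** The two points are [a + b] apart along the circle through [(0, 1)]; this is the chord length. *)
Lemma dist_arc_mirror (a b : R) : 0 <= a + b <= 2 * PI ->
  dist (arc a) (mirror (arc b)) = 2 * sin ((a + b) / 2).
Proof.
  intros H; assert (0 <= sin ((a + b) / 2)) by (apply sin_ge_0; lra).
  rewrite dist_sq, <- (sqrt_pow2 (2 * _)) by lra; f_equal.
  assert (I := sin2_cos2 a); assert (J := sin2_cos2 b).
  assert (D := cos_half (a + b)); rewrite cos_plus in D.
  unfold Rsqr in *; simpl; nra.
Qed.

(** * The inequality on each part of the trajectory *)

(** Exit at [arc s] with [s = 2 * r + 0.63573], other robot at distance [r] along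
    the first leg: [3.267595 + 2 * r = s + chi], [1.08489 + 2 * r = s + phi],
    [2.182705 = chi - phi], and the remaining half-time is [1.996135 - r]. *)
Lemma first_leg_numeric (r : R) : 0 <= r <= 0.05762 ->
  2 - 2 * cos (3.267595 + 2 * r) - 2 * r * (sin (1.08489 + 2 * r) + sin 2.182705)
  <= 1.996135 ^ 2 - 2 * 1.996135 * r.
Proof.
  intros Hr.
  assert (B1 : 0.998016 <= sin 1.6337975 <= 0.9980162) by sin_bounds.
  assert (B2 : -0.0629597 <= cos 1.6337975 <= -0.0629593).
  { assert (H := cos_enclosure 1.6337975 0.72902654 0.72902661 ltac:(lra)
      ltac:(sin_bounds)); lra. }
  assert (B3 : 0.884252 <= sin 1.08489 <= 0.8842521) by sin_bounds.
  assert (B4 : 0.46700 <= cos 1.08489 <= 0.46702).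
  { assert (H := cos_enclosure 1.08489 0.516231 0.516232 ltac:(lra)
      ltac:(sin_bounds)); lra. }
  assert (B5 : 0.818553 <= sin 2.182705 <= 0.818554) by sin_bounds.
  (* The angle 3.267595 exceeds the range of the Taylor enclosures, hence the doubling. *)
  assert (A1 := cos_2a_sin 1.6337975); assert (A2 := sin_2a 1.6337975).
  replace (2 * 1.6337975) with 3.267595 in A1, A2 by lra.
  rewrite cos_plus, sin_plus.
  assert (C1 : -0.992073 <= cos 3.267595 <= -0.9920717) by (rewrite A1; nra).
  assert (C2 : -0.1256697 <= sin 3.267595 <= -0.1256685) by (rewrite A2; nra).
  destruct (sin_small (2 * r)) as [S1 S2]; [lra|].
  destruct (cos_small (2 * r)) as [S3 S4]; [lra|].

  set (c2 := cos (2 * r)) in *; set (s2 := sin (2 * r)) in *.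
  (* The slack is nearly quadratic in [r] with minimum close to 0.0075; the products after this
     square control the higher powers. *)
  assert (P2 : 0 <= (r - 0.0075) ^ 2) by apply pow2_ge_0.
  assert (P3 : 0 <= r ^ 2 * r) by (apply Rmult_le_pos; [apply pow2_ge_0|lra]).
  assert (Q3 : 0 <= r ^ 2 * (0.05762 - r))
    by (apply Rmult_le_pos; [apply pow2_ge_0|lra]).
  assert (P4 : 0 <= r ^ 2 * r * r) by (apply Rmult_le_pos; lra).
  assert (Q4 : 0 <= r ^ 2 * r * (0.05762 - r)) by (apply Rmult_le_pos; lra).
  assert (Q2 : 0 <= r * (0.05762 - r)) by (apply Rmult_le_pos; lra).
  assert (c0 : 0 <= c2) by lra.
  assert (s0 : 0 <= s2) by lra.
  assert (T1 := Rmult_le_pos (cos 3.267595 + 0.992073) c2 ltac:(lra) c0).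
  assert (T2 := Rmult_le_pos (- sin 3.267595 - 0.1256685) s2 ltac:(lra) s0).
  assert (T3 : 0.884252 * c2 + 0.467 * s2 + 0.818553
    <= sin 1.08489 * c2 + cos 1.08489 * s2 + sin 2.182705).
  { assert (U1 := Rmult_le_pos (sin 1.08489 - 0.884252) c2 ltac:(lra) c0).
    assert (U2 := Rmult_le_pos (cos 1.08489 - 0.467) s2 ltac:(lra) s0); lra. }
  assert (T4 : 0.884252 * (1 - 2 * r ^ 2) + 0.467 * (2 * r - 4 / 3 * r ^ 3) + 0.818553
    <= 0.884252 * c2 + 0.467 * s2 + 0.818553) by lra.
  assert (T5 := Rmult_le_compat_l (2 * r) _ _ ltac:(lra) (Rle_trans _ _ _ T4 T3)).
  lra.
Qed.

(** Here [0.81152 - s / 2] and [0.847859] bound the other robot's distance to the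
    axis and minus its ordinate from above; the slack is smallest at about
    [s = 0.8458], the centre of the expansion. *)
Lemma centre_leg_numeric (s : R) : 0.75 <= s <= 1.62304 ->
  (sin s + 0.81152 - s / 2) ^ 2 + (cos s + 0.847859) ^ 2 <= (2.314 - s / 2) ^ 2.
Proof.
  intros Hs; set (v := s - 0.8458).
  assert (Hv : -0.1 <= v <= 0.77724) by (unfold v; lra).
  assert (B1 : 0.748501 <= sin 0.8458 <= 0.748503) by sin_bounds.
  assert (B2 : 0.663132 <= cos 0.8458 <= 0.663134).
  { assert (H := cos_enclosure 0.8458 0.4104065 0.4104069 ltac:(lra)
      ltac:(sin_bounds)); lra. }
  assert (I := sin2_cos2 s); unfold Rsqr in I.
  assert (E : s = 0.8458 + v) by (unfold v; lra).
  assert (F1 : sin s = sin 0.8458 * cos v + cos 0.8458 * sin v)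
    by (rewrite E, sin_plus; auto).
  assert (F2 : cos s = cos 0.8458 * cos v - sin 0.8458 * sin v)
    by (rewrite E, cos_plus; auto).
  clearbody v; destruct (cos_small v) as [C1 C2]; [lra|].
  set (p := sin 0.8458) in *; set (q := cos 0.8458) in *.
  assert (V2 := pow2_ge_0 v).
  assert (V2' : 0 <= (0.77724 - v) * (v + 0.1)) by (apply Rmult_le_pos; lra).
  assert (V4 : 0 <= v ^ 2 * ((0.77724 - v) * (v + 0.1)))
    by (now apply Rmult_le_pos).
  assert (W := pow2_ge_0 (v - 0.0001)).
  assert (C0 : 0 <= cos v) by lra.
  (* The squared sine and cosine sum to 1 and [s ^ 2 / 4] cancels, so only terms linear in [sin v]
     and [cos v] with coefficients affine in [v] remain. *)
  assert (G : (sin s + 0.81152 - s / 2) ^ 2 + (cos s + 0.847859) ^ 2 - (2.314 - s / 2) ^ 2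
    = 1 + 0.81152 ^ 2 + 0.847859 ^ 2 - 2.314 ^ 2 + (2.314 - 0.81152) * s
      + ((0.77724 - v) * p + 1.695718 * q) * cos v
      + ((0.77724 - v) * q - 1.695718 * p) * sin v).
  { transitivity ((sin s * sin s + cos s * cos s) + 0.81152 ^ 2 + 0.847859 ^ 2 - 2.314 ^ 2
      + (2.314 - 0.81152) * s + (1.62304 - s) * sin s + 1.695718 * cos s); [lra|].
    rewrite I, F1, F2, E; lra. }
  assert (A0 : (0.77724 - v) * p + 1.695718 * q
    <= (0.77724 - v) * 0.748503 + 1.695718 * 0.663134).
  { assert (0 <= (0.77724 - v) * (0.748503 - p)) by (apply Rmult_le_pos; lra); lra. }
  assert (T1 := Rmult_le_compat_r (cos v) _ _ C0 A0).
  assert (T2 := Rmult_le_compat_l ((0.77724 - v) * 0.748503 + 1.695718 * 0.663134)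
    _ _ ltac:(lra) C2).
  (* The coefficient of [sin v] is negative, so [sin v] is bounded below: by [v - v ^ 3 / 6] for
     [0 <= v], by [v] for negative [v]. *)
  destruct (Rle_lt_dec 0 v) as [P|N].
  - destruct (sin_small v) as [S1 S2]; [lra|].
    assert (Z : 0 <= v ^ 2 * (0.77724 - v)) by (apply Rmult_le_pos; lra).
    assert (V3 : 0 <= v ^ 2 * v) by (apply Rmult_le_pos; lra).
    assert (V5 : 0 <= v ^ 2 * v * v * v) by (repeat apply Rmult_le_pos; lra).
    assert (S0 : 0 <= sin v).
    { apply sin_ge_0; assert (Q := PI2_3_2); lra. }
    assert (B0 : (0.77724 - v) * q - 1.695718 * p
      <= (0.77724 - v) * 0.663134 - 1.695718 * 0.748501).
    { assert (0 <= (0.77724 - v) * (0.663134 - q)) by (apply Rmult_le_pos; lra); lra. }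
    assert (T3 := Rmult_le_compat_r (sin v) _ _ S0 B0).
    assert (T4 := Rmult_le_pos (1.695718 * 0.748501 - (0.77724 - v) * 0.663134)
      (sin v - (v - v ^ 3 / 6)) ltac:(lra) ltac:(lra)).
    lra.
  - destruct (sin_small (- v)) as [S1 S2]; [lra|]; rewrite sin_neg in S1, S2.
    assert (Z : 0 <= v ^ 2 * (- v)) by (apply Rmult_le_pos; lra).
    assert (S0 : 0 <= - sin v).
    { rewrite <- sin_neg; apply sin_ge_0; assert (Q := PI2_3_2); lra. }
    assert (B0 : (0.77724 - v) * 0.663132 - 1.695718 * 0.748503
      <= (0.77724 - v) * q - 1.695718 * p).
    { assert (0 <= (0.77724 - v) * (q - 0.663132)) by (apply Rmult_le_pos; lra); lra. }
    assert (T3 := Rmult_le_compat_r (- sin v) _ _ S0 B0).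
    assert (T4 := Rmult_le_pos (1.695718 * 0.748503 - (0.77724 - v) * 0.663132)
      (- v + sin v) ltac:(lra) ltac:(lra)).
    assert (W' := pow2_ge_0 (v + 0.0001)).
    assert (V5 : 0 <= v ^ 2 * (v * v) * (v + 0.1))
      by (apply Rmult_le_pos; [apply Rmult_le_pos; [auto|nra]|lra]).
    lra.
Qed.

(** The upper bound holds because [cos 1.6] is negative. *)
Lemma PI_bounds : 3 < PI < 3.2.
Proof.
  assert (P := PI2_3_2); split; [lra|].
  apply Rnot_le_lt; intros L.
  assert (H := cos_ge_0 1.6 ltac:(lra) ltac:(lra)).
  assert (K := cos_enclosure 1.6 0.717 0.718 ltac:(lra) ltac:(sin_bounds)); lra.
Qed.

(** [(S, C) = arc chi] is the end of the return leg, [(ex, - ey)] the unit vector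
    along it, [d] the distance left to walk, and [U + d] the remaining half-time. *)
Lemma return_leg_numeric (s d S C ex ey U : R) :
  0 <= s -> 0 <= d <= 0.4886 -> 2.60018 <= s + 2 * d <= 2.60022 ->
  0.4879394 <= S <= 0.4879397 -> -0.8728777 <= C <= -0.8728772 ->
  0.9986 <= ex <= 1 -> 0 <= ey -> ex ^ 2 + ey ^ 2 = 1 -> 1.01389 <= U ->
  S ^ 2 + C ^ 2 = 1 ->
  (sin s + S - d * ex) ^ 2 + (cos s - C - d * ey) ^ 2 <= (U + d) ^ 2.
Proof.
  intros Hs Hd He HS HC Hx Hy HE HU HI.
  assert (I := sin2_cos2 s); unfold Rsqr in I.
  set (v := 2.6003 - s).
  assert (Hv : 2 * d <= v <= 2 * d + 0.0002) by (unfold v; lra).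
  assert (E : s = 2.6003 - v) by (unfold v; lra).
  assert (B1 : 0.51523 <= sin 2.6003 <= 0.51525) by sin_bounds.
  assert (B2 : -0.85706 <= cos 2.6003 <= -0.85703).
  { assert (H := cos_enclosure 2.6003 0.963597 0.9636 ltac:(lra)
      ltac:(sin_bounds)); lra. }
  assert (P := PI_bounds).
  (* This fixes the sign of the [ey] term, which can then be dropped. *)
  assert (D : C <= cos s).
  { apply Rle_trans with (cos 2.6003); [lra|apply cos_decr_1; lra]. }
  assert (F1 : sin s = sin 2.6003 * cos v - cos 2.6003 * sin v)
    by (rewrite E, sin_minus; auto).
  assert (F2 : cos s = cos 2.6003 * cos v + sin 2.6003 * sin v)
    by (rewrite E, cos_minus; auto).
  clearbody v.
  destruct (sin_small v) as [S1 S2]; [lra|].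
  destruct (cos_small v) as [C1 C2]; [lra|].
  set (p := sin 2.6003) in *; set (q := cos 2.6003) in *.
  assert (V : 0 <= v * (0.9774 - v)) by (apply Rmult_le_pos; lra).
  assert (V3 : 0 <= v * v * (0.9774 - v))
    by (apply Rmult_le_pos; [apply Rle_0_sqr|lra]).
  assert (V4 : 0 <= v * v * (v * (0.9774 - v)))
    by (apply Rmult_le_pos; [apply Rle_0_sqr|lra]).
  assert (V5 : 0 <= v * v * v) by (repeat apply Rmult_le_pos; lra).
  assert (C0 : 0 <= cos v) by lra.
  assert (S0 : 0 <= sin v) by (apply sin_ge_0; lra).
  assert (L : 0.5152 * (1 - v ^ 2 / 2) + 0.857 * (v - v ^ 3 / 6) <= sin s).
  { assert (U1 := Rmult_le_pos (p - 0.5152) (cos v) ltac:(lra) C0).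
    assert (U2 := Rmult_le_pos (- q - 0.857) (sin v) ltac:(lra) S0); lra. }
  assert (M : S * sin s - C * cos s <= -0.496 * (1 - v ^ 2 / 2) + 0.869 * v).
  { assert (X1 := Rmult_le_compat S 0.4879397 p 0.51525 ltac:(lra) ltac:(lra)
      ltac:(lra) ltac:(lra)).
    assert (X2 := Rmult_le_compat 0.8728772 (- C) 0.85703 (- q) ltac:(lra) ltac:(lra)
      ltac:(lra) ltac:(lra)).
    assert (X3 := Rmult_le_compat S 0.4879397 (- q) 0.85706 ltac:(lra) ltac:(lra)
      ltac:(lra) ltac:(lra)).
    assert (X4 := Rmult_le_compat (- C) 0.8728777 p 0.51525 ltac:(lra) ltac:(lra)
      ltac:(lra) ltac:(lra)).
    assert (E1 : S * p - C * q <= -0.496) by lra.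
    assert (E2 : - S * q - C * p <= 0.869) by lra.
    assert (U1 := Rmult_le_pos (-0.496 - (S * p - C * q)) (cos v) ltac:(lra) C0).
    assert (U2 := Rmult_le_pos (0.869 - (- S * q - C * p)) (sin v) ltac:(lra) S0).
    rewrite F1, F2; lra. }
  assert (N : 0.9986 * (0.5152 * (1 - v ^ 2 / 2) + 0.857 * (v - v ^ 3 / 6) + 0.4879)
    <= ex * (sin s + S)) by (apply Rmult_le_compat; lra).
  assert (N1 : 0 <= d * (ey * (cos s - C))).
  { apply Rmult_le_pos; [lra|apply Rmult_le_pos; lra]. }
  assert (N2 := Rmult_le_compat_l d _ _ (proj1 Hd) N).
  set (Q := 0.9986 * _) in N, N2.
  assert (Q0 : 0 <= Q <= 1.9) by (unfold Q; lra).
  assert (N3 : (v / 2 - 0.0001) * Q <= d * Q) by (apply Rmult_le_compat_r; lra).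
  assert (N4 : 1.01389 * (1.01389 + 2 * d) <= U * (U + 2 * d))
    by (apply Rmult_le_compat; lra).
  assert (N5 : v * Q = v * (0.9986 * (0.5152 * (1 - v ^ 2 / 2)
    + 0.857 * (v - v ^ 3 / 6) + 0.4879))) by reflexivity.
  (* The three unit norms collapse, and [d ^ 2] cancels against the right-hand side, leaving
     [U * (U + 2 * d)] there. *)
  replace ((sin s + S - d * ex) ^ 2 + (cos s - C - d * ey) ^ 2) with
    ((sin s * sin s + cos s * cos s) + (S ^ 2 + C ^ 2) + 2 * (S * sin s - C * cos s)
     + d ^ 2 * (ex ^ 2 + ey ^ 2) - 2 * (d * (ex * (sin s + S)))
     - 2 * (d * (ey * (cos s - C)))) by ring.
  rewrite I, HI, HE; clearbody Q.
  lra.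
Qed.

(** The slack decreases in [s], so the tangent is taken at the right end: for [s = 0.63573] the
    other robot is just starting its detour at the midpoint time, and the sine has argument
    1.6337975. *)
Lemma pre_detour_numeric (s : R) : 0 <= s <= 0.63573 ->
  2 * sin ((s + (2.314 + s / 2)) / 2) <= 2.314 - s / 2.
Proof.
  intros Hs; assert (P := PI_bounds).
  assert (B1 : 0.998016 <= sin 1.6337975 <= 0.9980162) by sin_bounds.
  assert (B2 : -0.063 <= cos 1.6337975).
  { assert (H := cos_enclosure 1.6337975 0.7290265 0.7290267 ltac:(lra)
      ltac:(sin_bounds)); lra. }
  assert (T := sin_le_tangent ((s + (2.314 + s / 2)) / 2) 1.6337975
    ltac:(lra) ltac:(lra)).
  assert (0 <= (cos 1.6337975 + 0.063) * (0.63573 - s)) by (apply Rmult_le_pos; lra).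
  lra.
Qed.


(** * Duration of the detour, and meetings after it *)

Lemma return_leg_bounds : 0.48858 <= return_leg 2.631865 0.44916 0.05762 <= 0.488581.
Proof.
  rewrite return_leg_eq.
  assert (H1 := sin_chi); assert (H2 := sin_phi).
  split.
  - rewrite <- (sqrt_Rsqr 0.48858) by lra; apply sqrt_le_1_alt; unfold Rsqr; nra.
  - rewrite <- (sqrt_Rsqr 0.488581) by lra; apply sqrt_le_1_alt; unfold Rsqr; nra.
Qed.

Lemma centre_leg_bounds :
  centre_leg 2.631865 0.44916 0.05762 = sin 2.631865 - 0.05762 * cos 0.44916 /\
  0.4360344 <= centre_leg 2.631865 0.44916 0.05762 <= 0.4360350.
Proof.
  assert (H1 := sin_chi); assert (H2 := cos_phi).
  rewrite centre_leg_eq by lra; split; [auto|lra].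
Qed.

Lemma detour_end_bounds :
  4.614099 <= detour_end 2.631865 0.44916 0.05762 <= 4.614102.
Proof.
  assert (H1 := centre_leg_bounds); assert (H2 := return_leg_bounds).
  unfold detour_end; lra.
Qed.

(** In the next two lemmas [e] is the time at which the detour ends; the exit is
    found on the arc before the detour, respectively [x] after time [e]. *)
Lemma late_pre_detour_numeric (s e : R) :
  s <= 2.631865 -> 2.6001 <= s -> 4.614099 <= e <= 4.614102 ->
  2 * sin ((s + (2.631865 + ((5.628 + (1 + s)) / 2 - e))) / 2) <= 2.314 - s / 2.
Proof.
  intros Hs Hs' He; assert (P := PI_bounds).
  (* The base point lies just below the least argument of the sine; from there twice the sine falls
     faster than the right-hand side. *)
  assert (B1 : 0.50176 <= sin 2.615935 <= 0.50180) by sin_bounds.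
  assert (B2 : cos 2.615935 <= -0.8).
  { assert (H := cos_enclosure 2.615935 0.965 0.966 ltac:(lra)
      ltac:(sin_bounds)); lra. }
  set (w := (s + _) / 2).
  assert (Hw : 2.615935 <= w <= 3) by (unfold w; lra).
  assert (T := sin_le_tangent w 2.615935 ltac:(lra) ltac:(lra)).
  assert (0 <= (-0.8 - cos 2.615935) * (w - 2.615935)) by (apply Rmult_le_pos; lra).
  unfold w in *; lra.
Qed.

Lemma post_detour_numeric (x e : R) :
  0 <= x -> 4.614099 <= e <= 4.614102 ->
  2.631865 + (5.628 + (e + x)) / 2 - e <= PI -> 2.631865 + x <= PI ->
  2 * sin ((2.631865 + x + (2.631865 + ((5.628 + (e + x)) / 2 - e))) / 2)
  <= (5.628 - (e + x)) / 2.
Proof.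
  intros Hx He Hp Hq; assert (P := PI_bounds).
  (* The base point is the argument at [x = 0], rounded down. *)
  assert (B1 : 0.253456 <= sin 2.885339 <= 0.253459) by sin_bounds.
  assert (B2 : cos 2.885339 <= -0.9).
  { assert (H := cos_enclosure 2.885339 0.991 0.992 ltac:(lra)
      ltac:(sin_bounds)); lra. }
  set (w := (_ + _) / 2).
  assert (Hw : 2.885339 + 0.75 * x <= w) by (unfold w; lra).
  assert (T := sin_le_tangent w 2.885339 ltac:(unfold w in *; lra) ltac:(lra)).
  assert (0 <= (-0.9 - cos 2.885339) * (w - 2.885339)) by (apply Rmult_le_pos; lra).
  lra.
Qed.

(** * Coverage of the circle and assembly of the cases *)

Lemma on_circle_polar (X : point) : on_circle X ->
  exists s, 0 <= s <= PI /\ (mirror (arc s) = X \/ arc s = X).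
Proof.
  destruct X as [x y]; unfold on_circle; simpl; intros H.
  assert (Hy : -1 <= y <= 1).
  { unfold Rsqr in H; split; nra. }
  exists (acos y); split; [apply acos_bound|].
  unfold mirror, arc; simpl; rewrite cos_acos, sin_acos by auto.
  replace (1 - y²) with (x²) by lra; rewrite sqrt_Rsqr_abs.
  unfold Rabs; destruct Rcase_abs; [left|right]; f_equal; ring.
Qed.

(** Cases: the exit lies before or after the detour, and the other robot is in one of the phases at
    the midpoint time. *)
Lemma meeting_in_time (t : R) :
  let p := traj2 2.631865 0.44916 0.05762 in
  0 <= t <= detour_end 2.631865 0.44916 0.05762 + (PI - 2.631865) ->
  on_circle (p t) ->
  dist (p t) (mirror (p ((5.628 + t) / 2))) <= (5.628 - t) / 2.
Proof.
  intros p Ht Hc; unfold p in *; clear p.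
  assert (P := PI_bounds).
  assert (K1 := sin_chi); assert (K2 := cos_chi).
  assert (K3 := sin_phi); assert (K4 := cos_phi).
  destruct centre_leg_bounds as [L2 B2]; assert (B3 := return_leg_bounds).
  assert (BE := detour_end_bounds).
  assert (K5 : 0.81 <= sin 2.182705 <= 0.82) by sin_bounds.
  apply traj2_on_circle in Hc; try lra.
  2: { replace (2.631865 - 0.44916) with 2.182705 by lra; lra. }
  destruct Hc as [Hc|Hc].
  - rewrite traj2_pre_detour by lra.
    set (s := t - 1); assert (E : t = 1 + s) by (unfold s; ring); clearbody s; subst t.
    assert (Hs : 0 <= sin s) by (apply sin_ge_0; lra).
    set (m := (5.628 + (1 + s)) / 2).
    destruct (Rle_lt_dec m (1 + 2.631865)) as [M1|M1].
    { rewrite traj2_pre_detour, dist_arc_mirror by (unfold m in *; lra).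
      replace (m - 1) with (2.314 + s / 2) by (unfold m; lra).
      assert (N := pre_detour_numeric s ltac:(unfold m in *; lra)); lra. }
    destruct (Rle_lt_dec m (1 + 2.631865 + 0.05762)) as [M2|M2].
    { rewrite traj2_first_leg by lra.
      set (r := m - (1 + 2.631865)).
      assert (Er : s = 2 * r + 0.63573) by (unfold r, m; lra).
      assert (N := first_leg_numeric r ltac:(unfold r; lra)).
      replace (3.267595 + 2 * r) with (s + 2.631865) in N by lra.
      replace (1.08489 + 2 * r) with (s + 0.44916) in N by lra.
      replace 2.182705 with (2.631865 - 0.44916) in N by lra.
      rewrite cos_plus, sin_plus, sin_minus in N.
      replace (5.628 - (1 + s)) with (2 * (1.996135 - r)) by lra.
      apply dist_le; [unfold r; lra|]; simpl.
      assert (I1 := sin2_cos2 s); assert (I2 := sin2_cos2 2.631865).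
      assert (I3 := sin2_cos2 0.44916); unfold Rsqr in *.
      clear - N I1 I2 I3.
      set (S := sin 2.631865) in *; set (C := cos 2.631865) in *.
      set (a := sin 0.44916) in *; set (b := cos 0.44916) in *.
      (* The squared distance contains [r * r * (a * a + b * b)]. *)
      apply (f_equal (Rmult (r * r))) in I3.
      lra. }
    destruct (Rle_lt_dec m (1 + 2.631865 + 0.05762 +
      centre_leg 2.631865 0.44916 0.05762)) as [M3|M3].
    { rewrite traj2_centre_leg by lra.
      assert (N := centre_leg_numeric s ltac:(unfold m in *; lra)).
      apply dist_le; [lra|]; simpl fst; simpl snd.
      replace ((5.628 - (1 + s)) / 2) with (2.314 - s / 2) by lra.
      refine (Rle_trans _ _ _ _ N).
      (* Squaring is monotone only on nonnegative bases; here [cos s >= - sin 0.2]. *)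
      assert (0 <= cos s + 0.847858).
      { assert (cos (PI / 2 + 0.2) <= cos s) by (apply cos_decr_1; unfold m in *; lra).
        assert (J := sin_small 0.2 ltac:(lra)).
        rewrite cos_plus, cos_PI2, sin_PI2 in H; lra. }
      apply Rplus_le_compat; apply pow_incr; split; unfold m in *; lra. }
    destruct (Rle_lt_dec m (detour_end 2.631865 0.44916 0.05762)) as [M4|M4].
    { rewrite traj2_return_leg by lra; cbv zeta.
      set (e := detour_end _ _ _) in *; set (l := return_leg _ _ _) in *.
      assert (Pl : 0 < l) by lra.
      assert (Hl : l ^ 2 = (sin 2.631865) ^ 2 + (0.05762 * sin 0.44916) ^ 2).
      { unfold l; rewrite return_leg_eq, pow2_sqrt; [unfold Rsqr; ring|].
        apply Rplus_le_le_0_compat; apply Rle_0_sqr. }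
      set (S := sin 2.631865) in *; set (C := cos 2.631865) in *.
      set (a := sin 0.44916) in *.
      assert (Hx : 0.9986 <= S / l <= 1).
      { split; apply (Rmult_le_reg_r l); auto; unfold Rdiv;
          rewrite Rmult_assoc, Rinv_l, ?Rmult_1_r by lra; [lra|nra]. }
      assert (Hk : (S / l) ^ 2 + (0.05762 * a / l) ^ 2 = 1).
      { replace ((S / l) ^ 2 + (0.05762 * a / l) ^ 2) with (l ^ 2 / l ^ 2).
        - field; lra.
        - rewrite Hl at 1; unfold Rdiv; rewrite <- pow_inv; lra. }
      assert (Hd : forall z, (e - m) * (z / l) = (e - m) / l * z)
        by (intros z; unfold Rdiv; ring).
      assert (I2 := sin2_cos2 2.631865); unfold Rsqr in I2.
      assert (N := return_leg_numeric s (e - m) S C (S / l) (0.05762 * a / l) (5.628 - e)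
        ltac:(lra) ltac:(lra) ltac:(unfold m; lra) K1 K2 Hx
        ltac:(apply Rlt_le, Rdiv_lt_0_compat; lra) Hk ltac:(lra)
        ltac:(unfold S, C; lra)).
      rewrite !Hd in N.
      (* As [m] is the midpoint of [1 + s] and 5.628, half the remaining time is [5.628 - m]. *)
      replace ((5.628 - (1 + s)) / 2) with (5.628 - e + (e - m)) by (unfold m; lra).
      apply dist_le; [unfold m; lra|]; simpl fst; simpl snd.
      refine (Rle_trans _ _ _ (Req_le _ _ _) N); ring. }
    rewrite traj2_post_detour by lra.
    set (e := detour_end _ _ _) in *.
    rewrite Rmin_left by (unfold m; lra).
    rewrite dist_arc_mirror by (unfold m in *; lra).
    assert (N := late_pre_detour_numeric s e ltac:(lra) ltac:(unfold m in *; lra) BE).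
    unfold m; lra.
  - set (e := detour_end _ _ _) in *.
    rewrite !traj2_post_detour by (fold e; lra); fold e.
    rewrite (Rmin_left (_ + (t - e))) by lra.
    destruct (Rle_lt_dec (2.631865 + ((5.628 + t) / 2 - e)) PI) as [M|M].
    + rewrite Rmin_left, dist_arc_mirror by lra.
      assert (N := post_detour_numeric (t - e) e ltac:(lra) BE).
      replace (e + (t - e)) with t in N by ring; apply N; lra.
    (* The other robot already waits at [arc PI]. The chord to it is at most the arc, which by [M]
       is shorter than half the remaining time. *)
    + rewrite Rmin_right, dist_arc_mirror by lra.
      replace (sin _) with (sin ((PI - (2.631865 + (t - e))) / 2)).
      2: { rewrite <- sin_PI_x; f_equal; field. }
      assert (N := sin_small ((PI - (2.631865 + (t - e))) / 2) ltac:(lra)); lra.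
Qed.

Theorem theorem1 :
  Rbar_le (algorithm_evacuation_time 2.631865 0.44916 0.05762) (Finite 5.628).
Proof.
  assert (P := PI_bounds); assert (BE := detour_end_bounds).
  assert (K := sin_chi).
  apply evacuation_time_le with
    (* The time at which both robots arrive at [(0, -1)], the whole circle being explored. *)
    (tend := detour_end 2.631865 0.44916 0.05762 + (PI - 2.631865)).
  - apply traj2_continuous; lra.
  - lra.
  - intros X HX; destruct (on_circle_polar X HX) as [s [Hs E]].
    destruct (Rle_lt_dec s 2.631865).
    + exists (1 + s); split; [lra|].
      rewrite traj2_pre_detour by lra; now replace (1 + s - 1) with s by ring.
    + exists (detour_end 2.631865 0.44916 0.05762 + (s - 2.631865)); split; [lra|].
      rewrite traj2_post_detour by lra; rewrite Rmin_left by lra.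
      now replace (2.631865 + _) with s by ring.
  - intros t Ht Hc; now apply meeting_in_time.
Qed.
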